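(* Let $f$ be an arbitrary (randomized) mechanism for the $n$-agent single-facility location game in $\mathbb{R}^2$ with the $L_2$ (Euclidean) distance measure and doubly-peaked preferences (public locations, private preferred distances bounded by $B$) that is truthful-in-expectation. Then the additive approximation error of $f$ is at least $\frac{nB}{630500}$, i.e. $$\sup_{I}\ \mathbb{E}_{y\sim f(I)}\big[SC(y,I)-OPT(I)\big]\;\ge\;\frac{nB}{630500},$$ where the supremum is over instances $I$ with $n$ agents.
   Context: There is a set $N=\{1,\dots,n\}$ of $n$ agents and a constant $B$ bounding preferred distances. An instance is a tuple $I=\langle (x_1,b_1),\dots,(x_n,b_n)\rangle$, where $x_i\in\mathbb{R}^2$ is the fixed, publicly known location of agent $i$ and $b_i$, with $0\le b_i\le B$, is its private preferred distance to the facility. The cost of agent $i$ when the facility is at $y\in\mathbb{R}^2$ is $cost(y,(x_i,b_i))=b_i-\|x_i-y\|_2$ if $\|x_i-y\|_2\le b_i$, and $\|x_i-y\|_2-b_i$ otherwise. The social cost is $SC(y,I)=\sum_{i=1}^n cost(y,(x_i,b_i))$, and $OPT(I)=\min_{y\in\mathbb{R}^2}SC(y,I)$. A randomized mechanism is a function $f:(\mathbb{R}^2\times\mathbb{R})^n\to\Delta(\mathbb{R}^2)$, where $\Delta(\mathbb{R}^2)$ is the set of probability distributions on $\mathbb{R}^2$; $f(I)$ is the distribution of the facility location. It is truthful-in-expectation if for every instance $I$, every agent $i$ and every misreport $b_i'\in\mathbb{R}$, $\mathbb{E}_{y\sim f(I)}[cost(y,(x_i,b_i))]\le \mathbb{E}_{y\sim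 f(I')}[cost(y,(x_i,b_i))]$, where $I'$ is $I$ with $(x_i,b_i)$ replaced by $(x_i,b_i')$.
   Formalization: The number of agents is assumed to be at least 3, because the bound fails for n = 1 and n = 2 with B > 0: placing the facility on agent 1's circle of preferred distance, at a point closest to agent 2's circle, is truthful and optimal. *)

(* Defs.v *)
From HB Require Import structures.
From mathcomp Require Import all_boot all_order all_algebra.
From mathcomp Require Import all_classical all_reals all_analysis.
From mathcomp Require Import lra.

Set Implicit Arguments.
Unset Strict Implicit.
Unset Printing Implicit Defensive.

Import Order.TTheory GRing.Theory Num.Theory.
Import numFieldNormedType.Exports.

Local Open Scope classical_set_scope.
Local Open Scope ring_scope.

(* [measurableTypeR R] carries the Borel sigma-algebra of [R], so the product
   sigma-algebra on [plane R] is the Borel sigma-algebra of the plane. *)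
Definition plane (R : realType) := (measurableTypeR R * measurableTypeR R)%type.

(* The canonical norm of the library on [R * R] is the sup norm, hence the
   explicit Euclidean distance. *)
Definition dist2 (R : realType) (p q : plane R) : R :=
  Num.sqrt ((p.1 - q.1) ^+ 2 + (p.2 - q.2) ^+ 2).

(* An agent is a pair (location, preferred distance). *)
Definition agent (R : realType) := (plane R * R)%type.

Definition cost (R : realType) (y : plane R) (a : agent R) : R :=
  if dist2 a.1 y <= a.2 then a.2 - dist2 a.1 y else dist2 a.1 y - a.2.

Definition profile (R : realType) (n : nat) := 'I_n -> agent R.

Definition is_instance (R : realType) (n : nat) (B : R) (I : profile R n) : Prop :=
  forall i, 0 <= (I i).2 <= B.

Definition SC (R : realType) (n : nat) (y : plane R) (I : profile R n) : R :=
  \sum_(i < n) cost y (I i).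

Definition OPT (R : realType) (n : nat) (I : profile R n) : R :=
  inf [set SC y I | y in [set: plane R]].

Lemma costE (R : realType) (y : plane R) a : cost y a =
  `|dist2 a.1 y - a.2|.
Proof.
rewrite /cost; case: ifPn => [h|].
  by rewrite ler0_norm ?opprB// subr_le0.
by rewrite -ltNge => h; rewrite gtr0_norm// subr_gt0.
Qed.

Lemma SC_continuous (R : realType) n (I : profile R n) : continuous (fun y : R * R => SC y I).
Proof.
move=> y; rewrite /SC.
apply: cvg_big => [|i _]; first exact: add_continuous.
have -> : (fun y => cost y (I i)) = (fun y => `|dist2 (I i).1 y - (I i).2|) by apply/funext => z; exact: costE.
rewrite costE.
apply: cvg_norm; apply: cvgB; last exact: cvg_cst.
apply: (@continuous_comp _ _ _ (fun y : R*R => ((I i).1.1 - y.1)^+2 + ((I i).1.2 - y.2)^+2) (@Num.sqrt R)); last exact: sqrt_continuous.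
apply: cvgD; apply: cvgM; apply: cvgB; try exact: cvg_cst; (exact: cvg_fst || exact: cvg_snd).
Qed.

Lemma dist2_ge (R : realType) (p q : plane R) : `|p.1-q.1| <= dist2 p q /\ `|p.2-q.2| <= dist2 p q.
Proof. by split; rewrite -sqrtr_sqr /dist2 ler_wsqrtr// ?lerDl ?lerDr sqr_ge0. Qed.

(* The infimum defining [OPT] is a minimum. *)
Lemma OPT_attained (R : realType) n (I : profile R n) :
  exists y, OPT I = SC y I /\ forall z, SC y I <= SC z I.
Proof.
suff [y hy] : exists y, forall z, SC y I <= SC z I.
  exists y; split=> //; apply/eqP; rewrite eq_le; apply/andP; split.
    apply: ge_inf; last by exists y.
    by exists (SC y I) => _ [z _ <-].
  apply: lb_le_inf; first by exists (SC y I), y.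
  by move=> _ [z _ <-].
case: n I => [|n] I.
  by exists (0,0) => z; rewrite /SC !big_ord0.
pose x := (I ord0).1; pose b := (I ord0).2; pose M := SC x I + `|b|.
have M0 : 0 <= M by rewrite addr_ge0// sumr_ge0// => i _; rewrite costE.
pose A := `[x.1 - M, x.1 + M] `*` `[x.2 - M, x.2 + M] : set (R * R).
have Ax : A x by split; rewrite /= in_itv/=; apply/andP; split; lra.
have [|||y _ hy] := @compact_EVT_min (R*R)%type R (fun y => SC y I) A.
- by exists x.
- by apply: compact_setX; exact: segment_compact.
- exact/continuous_subspaceT/SC_continuous.
exists y => z; have [Az|nAz] := pselect (A z); first by apply: hy; rewrite inE.
apply: (le_trans (hy x _)); first by rewrite inE.
rewrite leNgt; apply/negP => h; apply: nAz.
have : dist2 x z <= M.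
  have : cost z (I ord0) <= SC z I.
    by rewrite /SC big_ord_recl lerDl sumr_ge0// => i _; rewrite costE.
  rewrite costE -/x -/b => h1.
  have := ler_norm (dist2 x z - b); have := ler_norm b; rewrite /M; lra.
have [] := dist2_ge x z; rewrite !ler_norml => /andP[? ?] /andP[? ?] ?.
by split; rewrite /= in_itv/=; apply/andP; split; lra.
Qed.

Definition mechanism (R : realType) (n : nat) :=
  profile R n -> probability (plane R) R.

(* The profile [I] in which agent [i] reports [b'] and keeps its location. *)
Definition misreport (R : realType) (n : nat) (I : profile R n) (i : 'I_n)
    (b' : R) : profile R n :=
  dfwith I i ((I i).1, b').

(* Costs are nonnegative, so every expectation below is a well-defined element
   of [0, +oo], without integrability assumptions. *)
Definition expected_cost (R : realType) (P : probability (plane R) R)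
    (a : agent R) : \bar R :=
  (\int[P]_y (cost y a)%:E)%E.

(* The true instance has preferred distances in [0, B]; a misreport is an
   arbitrary real number. *)
Definition truthful_in_expectation (R : realType) (n : nat) (B : R)
    (f : mechanism R n) : Prop :=
  forall (I : profile R n) (i : 'I_n) (b' : R), is_instance B I ->
    (expected_cost (f I) (I i) <= expected_cost (f (misreport I i b')) (I i))%E.

Definition additive_error (R : realType) (n : nat) (B : R) (f : mechanism R n) :
    \bar R :=
  ereal_sup [set (\int[f I]_y (SC y I - OPT I)%:E)%E | I in [set I | is_instance B I]].

(* Main.v *)
(* Put m = n/3 agents at W = (-B,0), m agents at E = (B,0) and the remaining
   n - 2m >= m agents at the origin with preferred distance B.  If W and E both
   prefer distance 0, the optima are the points W and E themselves, where the
   costs |d - B/2| of the two groups sum to 2B per pair of agents.  If W prefers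
   B/2 instead, the only optimum is E, at cost 3B/2 > B for each agent of W; an
   almost optimal mechanism charges them at least 6B/5, up to a multiple of its
   error, and likewise for E.  By truthfulness these agents would not gain by
   reporting 0, so at the symmetric profile the two groups would pay at least
   12B/5 > 2B per pair: the error is at least 2mB/65 >= 2nB/325. *)

Require Import Defs.
From mathcomp Require Import all_boot all_order all_algebra.
From mathcomp Require Import all_classical all_reals all_analysis.
From mathcomp Require Import measurable_realfun.
From mathcomp Require Import zify ring lra.

Set Implicit Arguments.
Unset Strict Implicit.
Unset Printing Implicit Defensive.

Import Order.TTheory GRing.Theory Num.Theory.
Import numFieldNormedType.Exports.

Local Open Scope ring_scope.

(** * Positivity and measurability of costs *)

Lemma cost_ge0 (R : realType) (y : plane R) (a : agent R) : 0 <= cost y a.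
Proof. by rewrite costE. Qed.

Lemma dist2_ge0 (R : realType) (p q : plane R) : 0 <= dist2 p q.
Proof. exact: sqrtr_ge0. Qed.

Lemma sqr_dist2 (R : realType) (p q : plane R) :
  dist2 p q ^+ 2 = (p.1 - q.1) ^+ 2 + (p.2 - q.2) ^+ 2.
Proof. by rewrite sqr_sqrtr// addr_ge0 ?sqr_ge0. Qed.

Lemma measurable_cost (R : realType) (a : agent R) :
  measurable_fun setT (fun y : plane R => cost y a).
Proof.
rewrite (_ : (fun y => _) = fun y : plane R => `|dist2 a.1 y - a.2|); last first.
  by apply/funext => y; exact: costE.
apply: measurableT_comp => //.
apply: measurable_funB; last exact: measurable_cst.
apply: measurableT_comp.
  by apply: continuous_measurable_fun; exact: sqrt_continuous.
by apply: measurable_funD; apply: measurable_funX;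
  apply: measurable_funB => //; exact: measurable_cst.
Qed.

Lemma measurable_SC (R : realType) n (I : profile R n) :
  measurable_fun setT (fun y : plane R => SC y I).
Proof. by apply: measurable_sum => i; exact: measurable_cost. Qed.

Lemma OPT_le (R : realType) n (I : profile R n) (y : plane R) : OPT I <= SC y I.
Proof. by have [z [-> ]] := OPT_attained I; apply. Qed.

(** * Error and group truthfulness of a mechanism *)

Lemma additive_error_ge (R : realType) n (B : R) (f : mechanism R n)
    (I : profile R n) : is_instance B I ->
  (\int[f I]_y (SC y I - OPT I)%:E <= additive_error B f)%E.
Proof. by move=> hI; apply: ereal_sup_ubound; exists I. Qed.

(* Switch the coalition's reports one agent at a time: the agent who switches
   still has the true preference, so no step lowers the expected cost. *)
Lemma coalition_truthful (R : realType) n (B : R) (f : mechanism R n)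
    (I J : profile R n) (x : plane R) (b b' : R) :
    truthful_in_expectation B f -> is_instance B I -> is_instance B J ->
    (forall i, I i = J i \/ (I i = (x, b) /\ J i = (x, b'))) ->
  (expected_cost (f I) (x, b) <= expected_cost (f J) (x, b))%E.
Proof.
move=> hf hI hJ hIJ.
pose K k : profile R n := fun i => if (i < k)%N then J i else I i.
have K0 : K 0%N = I by apply/funext => i; rewrite /K ltn0.
have Kn : K n = J by apply/funext => i; rewrite /K ltn_ord.
rewrite -{1}K0 -Kn; elim: {-2}n (leqnn n) => [//|k IHk] ltkn.
apply: (le_trans (IHk (ltnW ltkn))).
pose i0 := Ordinal ltkn.
have KS i : K k.+1 i = if i == i0 then J i else K k i.
  rewrite /K ltnS leq_eqVlt -(inj_eq val_inj) /=.
  by case: eqP => //= ->.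
have Ki0 : K k i0 = I i0 by rewrite /K ltnn.
case: (hIJ i0) => [e|[eI eJ]].
  suff -> : K k.+1 = K k by [].
  by apply/funext => i; rewrite KS; case: eqP => // ->; rewrite Ki0.
have hK : is_instance B (K k) by move=> i; rewrite /K; case: ifP.
have := hf (K k) i0 b' hK; rewrite Ki0 eI /=.
suff -> : misreport (K k) i0 b' = K k.+1 by [].
apply/funext => i; rewrite KS /misreport Ki0 eI /=.
case: eqP => [->|/eqP ne]; first by rewrite dfwithin.
by rewrite dfwithout// eq_sym.
Qed.

(** * Profiles made of three groups of agents *)

Definition three_groups (R : realType) (n m : nat) (a b c : agent R) :
    profile R n :=
  fun i => if (i < m)%N then a else if (i < m + m)%N then b else c.
Arguments three_groups {R} n m a b c _.

Lemma is_instance_three_groups (R : realType) n m (B : R) (a b c : agent R) :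
  0 <= a.2 <= B -> 0 <= b.2 <= B -> 0 <= c.2 <= B ->
  is_instance B (three_groups n m a b c).
Proof. by move=> ha hb hc i; rewrite /three_groups; do 2?case: ifP. Qed.

Lemma SC_three_groups (R : realType) m k (a b c : agent R) (y : plane R) :
  SC y (three_groups (m + (m + k)) m a b c) =
  m%:R * cost y a + m%:R * cost y b + k%:R * cost y c.
Proof.
rewrite /SC /three_groups !big_split_ord /= -addrA; congr +%R; last congr +%R.
- under eq_bigr => i _ do rewrite ltn_ord.
  by rewrite sumr_const card_ord mulr_natl.
- under eq_bigr => i _ do rewrite ltnNge leq_addr /= ltn_add2l ltn_ord.
  by rewrite sumr_const card_ord mulr_natl.
- under eq_bigr => i _ do
    rewrite ltnNge leq_addr /= ltn_add2l ltnNge leq_addr /=.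
  by rewrite sumr_const card_ord mulr_natl.
Qed.

(** [OPT] is at most the social cost at [z], where the third group pays nothing. At [y], only [m] of
    the [k] agents of that group are counted, so that the bound is [m] times an excess per triple of
    agents. *)
Lemma excess_three_groups (R : realType) m k (a b c : agent R) (y z : plane R) :
    (m <= k)%N -> cost z c = 0 ->
  m%:R * (cost y a + cost y b + cost y c - (cost z a + cost z b)) <=
  SC y (three_groups (m + (m + k)) m a b c) -
    OPT (three_groups (m + (m + k)) m a b c).
Proof.
move=> mk zc; have := OPT_le (three_groups (m + (m + k)) m a b c) z.
rewrite !SC_three_groups zc.
have : m%:R * cost y c <= k%:R * cost y c.
  by rewrite ler_wpM2r ?cost_ge0// ler_nat.
lra.
Qed.

(** * Expectations of nonnegative functions *)

Lemma expectation_lincomb (d : measure_display) (T : measurableType d)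
    (R : realType) (P : probability T R) (a b : R) (F G : T -> R) :
    0 <= a -> 0 <= b -> measurable_fun setT F -> measurable_fun setT G ->
    (forall y, 0 <= F y) -> (forall y, 0 <= G y) ->
  (\int[P]_y (a * F y + b * G y)%:E =
   a%:E * \int[P]_y (F y)%:E + b%:E * \int[P]_y (G y)%:E)%E.
Proof.
move=> a0 b0 mF mG F0 G0; under eq_integral do rewrite EFinD !EFinM.
have mF' : measurable_fun setT (fun y => (F y)%:E) by exact/measurable_EFinP.
have mG' : measurable_fun setT (fun y => (G y)%:E) by exact/measurable_EFinP.
rewrite ge0_integralD//.
- rewrite !ge0_integralZl_EFin//.
  + by move=> y _; rewrite lee_fin.
  + by move=> y _; rewrite lee_fin.
- by move=> y _; rewrite -EFinM lee_fin mulr_ge0.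
- exact: measurable_funeM.
- by move=> y _; rewrite -EFinM lee_fin mulr_ge0.
- exact: measurable_funeM.
Qed.

Lemma expectation_le (d : measure_display) (T : measurableType d)
    (R : realType) (P : probability T R) (F G : T -> R) :
    measurable_fun setT F -> measurable_fun setT G ->
    (forall y, 0 <= F y) -> (forall y, F y <= G y) ->
  (\int[P]_y (F y)%:E <= \int[P]_y (G y)%:E)%E.
Proof.
move=> mF mG F0 FG; apply: ge0_le_integral => //.
- by move=> y _; rewrite lee_fin.
- exact/measurable_EFinP.
- exact/measurable_EFinP.
- by move=> y _; rewrite lee_fin.
Qed.

Lemma expectation_cst (d : measure_display) (T : measurableType d)
    (R : realType) (P : probability T R) (c : R) :
  (\int[P]_y c%:E = c%:E)%E.
Proof.
rewrite (eq_integral (cst c%:E))// integral_cst// -[RHS]mule1.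
by congr (_ * _)%E; exact: probability_setT.
Qed.

Lemma ge0_le_EFin (R : realType) (x : \bar R) (r : R) :
  (0 <= x)%E -> (x <= r%:E)%E -> exists2 s, x = s%:E & 0 <= s <= r.
Proof. by case: x => [s| |]//; rewrite !lee_fin => s0 sr; exists s; rewrite ?s0. Qed.

(** * Distances to W, E and their midpoint *)

Lemma dist2_axis (R : realType) (a b : R) : dist2 (a, 0) (b, 0) = `|a - b|.
Proof. by rewrite /dist2 /= subrr expr0n addr0 sqrtr_sqr. Qed.

(** The median identity: the origin is the midpoint of W and E. *)
Lemma apollonius (R : realType) (B : R) (y : plane R) :
  dist2 (- B, 0) y ^+ 2 + dist2 (B, 0) y ^+ 2 =
  2 * dist2 (0, 0) y ^+ 2 + 2 * B ^+ 2.
Proof. by rewrite !sqr_dist2 /=; ring. Qed.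

Lemma le_add_dist2 (R : realType) (B : R) (y : plane R) :
  2 * B <= dist2 (- B, 0) y + dist2 (B, 0) y.
Proof.
have [+ _] := dist2_ge (- B, 0) y; have [+ _] := dist2_ge (B, 0) y.
by rewrite !ler_norml /= => /andP[? ?] /andP[? ?]; lra.
Qed.

(* If both terms are small, then d3 > 4B/5, whereas d1 and d2 are so close to
   each other that apollonius forces d3 ^+ 2 <= 57/100 * B ^+ 2. *)
Lemma excess_or_cost (R : realType) (B d1 d2 d3 : R) :
    0 <= B -> 0 <= d1 -> 0 <= d2 -> 0 <= d3 ->
    d1 ^+ 2 + d2 ^+ 2 = 2 * d3 ^+ 2 + 2 * B ^+ 2 -> 2 * B <= d1 + d2 ->
  6 / 5 * B <= 6 * (`|d1 - B / 2| + d2 + `|d3 - B| - 3 / 2 * B) + `|d1 - B / 2|.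
Proof.
move=> B0 d10 d20 d30 apo tri; rewrite leNgt; apply/negP => small.
have h3 : B - d3 <= `|d3 - B| by rewrite distrC ler_norm.
have p3 := normr_ge0 (d3 - B).
suff [d3B sq] : 4 / 5 * B < d3 /\ d1 ^+ 2 + d2 ^+ 2 <= 314 / 100 * B ^+ 2.
  have : (4 / 5 * B) ^+ 2 < d3 ^+ 2 by rewrite ltr_pXn2r ?nnegrE//; lra.
  have := sqr_ge0 B; rewrite exprMn; lra.
have [le1|lt1] := leP (B / 2) d1.
  move: small; rewrite ger0_norm ?subr_ge0// => small.
  split; first lra.
  (* With [2 * B <= d1 + d2], [small] yields [d1 < 17/10 * B] and [d2 <= 22/10 * B - d1]. The convex
     function [d1 ^+ 2 + (22/10 * B - d1) ^+ 2] takes the value [314/100 * B ^+ 2] at both ends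
     [B / 2] and [17/10 * B], so the product of the two slacks bounds it in between. *)
  have : d2 ^+ 2 <= (22 / 10 * B - d1) ^+ 2 by rewrite ler_pXn2r ?nnegrE//; lra.
  have : 0 <= (d1 - B / 2) * (17 / 10 * B - d1) by rewrite mulr_ge0//; lra.
  lra.
move: small; rewrite ltr0_norm ?subr_lt0// => small.
split; first lra.
have : d1 ^+ 2 <= (B / 2) ^+ 2 by rewrite ler_pXn2r ?nnegrE//; lra.
have : d2 ^+ 2 <= (17 / 10 * B) ^+ 2 by rewrite ler_pXn2r ?nnegrE//; lra.
lra.
Qed.

(** The two terms cannot both have [d < B / 2], as the distances sum to at least [2 * B]. This
    compares the costs for peaks [B / 2] with those for peaks 0 at the symmetric profile. *)
Lemma cost_sum_le (R : realType) (B d1 d2 : R) :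
    0 <= B -> 0 <= d1 -> 0 <= d2 -> 2 * B <= d1 + d2 ->
  `|d1 - B / 2| + `|d2 - B / 2| <= d1 + d2.
Proof.
move=> B0 d10 d20 tri.
by case: (lerP (B / 2) d1) => h1; case: (lerP (B / 2) d2) => h2; lra.
Qed.

Theorem theorem8 (R : realType) (n : nat) (B : R) (f : mechanism R n)
  (hn : (2 < n)%N) (hB : 0 <= B) (hf : truthful_in_expectation B f) :
  ((n%:R * B / 630500%:R)%:E <= additive_error B f)%E.
Proof.
have [m [k [m0 mk n5 nE]]] :
    exists m k, [/\ (0 < m)%N, (m <= k)%N, (n <= 5 * m)%N & n = (m + (m + k))%N].
  (* Here [n <= 3 * m + 2 <= 5 * m], because [2 < n] gives [1 <= m]. *)
  by exists (n %/ 3)%N, (n - (n %/ 3 + n %/ 3))%N; split; lia.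
subst n.
pose west b : agent R := ((- B, 0), b); pose east b : agent R := ((B, 0), b).
pose I b b' := three_groups (m + (m + k)) m (west b) (east b') ((0, 0), B).
have hI b b' : 0 <= b <= B -> 0 <= b' <= B -> is_instance B (I b b').
  by move=> ? ?; apply: is_instance_three_groups => //=; rewrite hB lexx.
have h0 : 0 <= (0 : R) <= B by rewrite lexx.
have h2 : 0 <= B / 2 <= B by apply/andP; split; lra.
pose exc b b' y := SC y (I b b') - OPT (I b b').
have exc0 b b' y : 0 <= exc b b' y by rewrite subr_ge0 OPT_le.
have mexc b b' : measurable_fun setT (exc b b').
  by apply: measurable_funB; [exact: measurable_SC | exact: measurable_cst].
have dWE : dist2 (- B, 0) (B, 0) = 2 * B.
  by rewrite dist2_axis ler0_norm; lra.
have dEW : dist2 (B, 0) (- B, 0) = 2 * B.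
  by rewrite dist2_axis ger0_norm; lra.
have dEE : dist2 (B, 0) (B, 0) = 0 by rewrite dist2_axis subrr normr0.
have dWW : dist2 (- B, 0) (- B, 0) = 0 by rewrite dist2_axis subrr normr0.
have cE : cost (B, 0) ((0, 0), B) = 0.
  by rewrite costE dist2_axis sub0r normrN (ger0_norm hB) subrr normr0.
have cW : cost (- B, 0) ((0, 0), B) = 0.
  by rewrite costE dist2_axis sub0r opprK (ger0_norm hB) subrr normr0.
have mR : 0 < m%:R :> R by rewrite ltr0n.
have exc_west y : m%:R * (6 / 5 * B) <=
    6 * exc (B / 2) 0 y + m%:R * cost y (west (B / 2)).
  (* The reference point is E, where only the west group pays, namely [3 / 2 * B] each. *)
  have := @excess_three_groups R m k (west (B / 2)) (east 0) _ y _ mk cE.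
  rewrite -/(I (B / 2) 0) -/(exc (B / 2) 0 y) !costE /= dWE dEE !subr0 normr0.
  rewrite (ger0_norm (_ : 0 <= 2 * B - B / 2)); last lra.
  rewrite (ger0_norm (dist2_ge0 _ _)) => ex.
  have := excess_or_cost hB (dist2_ge0 _ _) (dist2_ge0 _ _) (dist2_ge0 _ _)
    (apollonius B y) (le_add_dist2 B y).
  rewrite -(ler_pM2l mR); lra.
have exc_east y : m%:R * (6 / 5 * B) <=
    6 * exc 0 (B / 2) y + m%:R * cost y (east (B / 2)).
  have := @excess_three_groups R m k (west 0) (east (B / 2)) _ y _ mk cW.
  rewrite -/(I 0 (B / 2)) -/(exc 0 (B / 2) y) !costE /= dEW dWW !subr0 normr0.
  rewrite (ger0_norm (_ : 0 <= 2 * B - B / 2)); last lra.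
  rewrite (ger0_norm (dist2_ge0 _ _)) => ex.
  (* The mirror image of [exc_west]: the two distances exchange their roles. *)
  have := apollonius B y; have := le_add_dist2 B y; rewrite addrC => tri.
  rewrite addrC => apo.
  have := excess_or_cost hB (dist2_ge0 _ _) (dist2_ge0 _ _) (dist2_ge0 _ _)
    apo tri.
  rewrite -(ler_pM2l mR); lra.
have exc_sym y : m%:R * cost y (west (B / 2)) + m%:R * cost y (east (B / 2)) <=
    (* The factors 1 give the right side the shape of [expectation_lincomb]. *)
    1 * exc 0 0 y + 1 * (m%:R * (2 * B)).
  have := @excess_three_groups R m k (west 0) (east 0) _ y _ mk cE.
  rewrite -/(I 0 0) -/(exc 0 0 y) !costE /= dWE dEE !subr0 normr0.
  rewrite !(ger0_norm (dist2_ge0 _ _)) (ger0_norm (_ : 0 <= 2 * B)); last lra.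
  have p3 := normr_ge0 (dist2 (0, 0) y - B).
  have := cost_sum_le hB (dist2_ge0 _ _) (dist2_ge0 _ _) (le_add_dist2 B y).
  rewrite -(ler_pM2l mR) => h1 h2'.
  have := mulr_ge0 (ltW mR) p3; lra.
have err b b' : 0 <= b <= B -> 0 <= b' <= B ->
    (\int[f (I b b')]_y (exc b b' y)%:E <= additive_error B f)%E.
  by move=> hb hb'; exact/additive_error_ge/hI.
have int_exc0 b b' : (0 <= \int[f (I b b')]_y (exc b b' y)%:E)%E.
  by apply: integral_ge0 => y _; rewrite lee_fin.
(* An infinite error is trivial and [-oo] contradicts [int_exc0]; a real error makes the three
   expected excesses finite. *)
case: (additive_error B f) err => [r| |] err; first last.
- by have := le_trans (int_exc0 0 0) (err 0 0 h0 h0).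
- exact: leey.
have [e0 e0E /andP[_ e0r]] := ge0_le_EFin (int_exc0 0 0) (err _ _ h0 h0).
have [e1 e1E /andP[_ e1r]] := ge0_le_EFin (int_exc0 _ _) (err _ _ h2 h0).
have [e2 e2E /andP[_ e2r]] := ge0_le_EFin (int_exc0 _ _) (err _ _ h0 h2).
have EC0 J a : (0 <= expected_cost (f J) a)%E.
  by apply: integral_ge0 => y _; rewrite lee_fin cost_ge0.
have truthW : (expected_cost (f (I (B / 2)%R 0%R)) (west (B / 2)%R) <=
    expected_cost (f (I 0%R 0%R)) (west (B / 2)%R))%E.
  apply: (coalition_truthful (b' := 0) hf) => [||i]; [exact: hI..|].
  by rewrite /I /three_groups; do 2?case: ifP => _; [right|left|left].
have truthE : (expected_cost (f (I 0%R (B / 2)%R)) (east (B / 2)%R) <=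
    expected_cost (f (I 0%R 0%R)) (east (B / 2)%R))%E.
  apply: (coalition_truthful (b' := 0) hf) => [||i]; [exact: hI..|].
  by rewrite /I /three_groups; do 2?case: ifP => _; [left|right|left].
have intW : ((m%:R * (6 / 5 * B))%:E <= 6%:E * e1%:E +
    m%:R%:E * expected_cost (f (I (B / 2)%R 0%R)) (west (B / 2)%R))%E.
  rewrite -e1E -[leLHS](expectation_cst (f (I (B / 2) 0))).
  rewrite -expectation_lincomb//; [|exact: measurable_cost|].
    apply: expectation_le => //.
    - by apply: measurable_funD; apply: measurable_funM => //;
        exact: measurable_cost.
    - by move=> _; rewrite !mulr_ge0.
  by move=> y; exact: cost_ge0.
have intE : ((m%:R * (6 / 5 * B))%:E <= 6%:E * e2%:E +
    m%:R%:E * expected_cost (f (I 0%R (B / 2)%R)) (east (B / 2)%R))%E.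
  rewrite -e2E -[leLHS](expectation_cst (f (I 0 (B / 2)))).
  rewrite -expectation_lincomb//; [|exact: measurable_cost|].
    apply: expectation_le => //.
    - by apply: measurable_funD; apply: measurable_funM => //;
        exact: measurable_cost.
    - by move=> _; rewrite !mulr_ge0.
  by move=> y; exact: cost_ge0.
have int0 : (m%:R%:E * expected_cost (f (I 0%R 0%R)) (west (B / 2)%R) +
    m%:R%:E * expected_cost (f (I 0%R 0%R)) (east (B / 2)%R) <=
    (e0 + m%:R * (2 * B))%:E)%E.
  rewrite EFinD -e0E -[X in (_ <= _ + X)%E](expectation_cst (f (I 0 0))).
  rewrite -[X in (_ <= X + _)%E]mul1e -[X in (_ <= _ + X)%E]mul1e.
  rewrite -!expectation_lincomb//; first last.
  - by move=> y; exact: cost_ge0.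
  - by move=> y; exact: cost_ge0.
  - exact: measurable_cost.
  - exact: measurable_cost.
  - by move=> _; rewrite !mulr_ge0.
  apply: expectation_le => //.
  - by apply: measurable_funD; apply: measurable_funM => //;
      exact: measurable_cost.
  - by apply: measurable_funD; apply: measurable_funM => //.
  - by move=> y; rewrite addr_ge0// mulr_ge0 ?cost_ge0.
have n5R : (m + (m + k))%:R <= 5 * m%:R :> R.
  by rewrite -natrM ler_nat.
have := ler_wpM2r hB n5R.
move: intW intE int0 truthW truthE.
have := EC0 (I (B / 2) 0) (west (B / 2)%R).
have := EC0 (I 0 (B / 2)) (east (B / 2)%R).
have := EC0 (I 0 0) (west (B / 2)%R).
have := EC0 (I 0 0) (east (B / 2)%R).
have mE : (0 < m%:R%:E :> \bar R)%E by rewrite lte_fin.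
(* All four expected costs are finite: [int0] bounds those at the symmetric profile, since [0 < m],
   and truthfulness carries the bound to the other two. *)
case: (expected_cost (f (I 0 0)) (west _)) => [w0| |]//;
case: (expected_cost (f (I 0 0)) (east _)) => [w1| |]//;
case: (expected_cost (f (I 0 (B / 2))) _) => [w2| |]//;
case: (expected_cost (f (I (B / 2) 0)) _) => [w3| |]//;
rewrite ?gt0_muley //= => _ _ _ _.
rewrite -?EFinM -?EFinD !lee_fin => i1 i2 i3 t1 t2.
have := ler_wpM2l (ltW mR) t1; have := ler_wpM2l (ltW mR) t2.
have mB := mulr_ge0 (ltW mR) hB.
set nB := _%:R * B => tE tW nBm.
have nB0 : 0 <= nB by rewrite mulr_ge0.
(* Adding the five inequalities gives [2 / 5 * m * B <= e0 + 6 * e1 + 6 * e2 <= 13 * r]. With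
   [n <= 5 * m] this is [r >= 2 / 325 * nB], and 163 rounds up [325 / 2]. *)
apply: (@le_trans _ _ (nB / 163)); last by lra.
by rewrite ler_wpM2l// lef_pV2 ?posrE ?ltr0n// ler_nat.
Qed.
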